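(* A Tychonoff space $X$ belongs to Frolík's class $\mathfrak{P}^\ast$ if and only if $X$ is selectively $\omega$-bounded.
   Context: All topological spaces are assumed to be Tychonoff (completely regular Hausdorff). The class $\mathfrak{P}^\ast$ consists of the spaces $X$ with the property: each infinite collection of pairwise disjoint open subsets of $X$ has an infinite subcollection each member of which meets some fixed compact subset of $X$ (the same compact set for all members of the subcollection). A space $X$ is selectively $\omega$-bounded if for any sequence $\{U_n\}_{n\in\omega}$ of nonempty open subsets of $X$ there exists a sequence $(x_n)_{n\in\omega}\in\prod_{n\in\omega}U_n$ containing a subsequence $(x_{n_k})_{k\in\omega}$ with compact closure (i.e. the closure in $X$ of the set $\{x_{n_k}:k\in\omega\}$ is compact). *)

(* Defs.v *)
From mathcomp Require Import all_boot all_order.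
From mathcomp Require Import all_classical all_reals all_analysis.

Set Implicit Arguments.
Unset Strict Implicit.
Unset Printing Implicit Defensive.

Local Open Scope classical_set_scope.

(* [completely_regular_space] does not include Hausdorff separation; by
   [uniform_separatorP] it is separation of points from closed sets by
   continuous functions into the real unit interval. *)
Definition tychonoff_space (X : topologicalType) : Prop :=
  completely_regular_space X /\ hausdorff_space X.

Definition frolik_Pstar (X : topologicalType) : Prop :=
  forall C : set (set X),
    infinite_set C -> C `<=` open -> trivIset C id ->
  exists C' : set (set X),
    [/\ C' `<=` C, infinite_set C' &
        exists2 K : set X, compact K & forall U, C' U -> U `&` K !=set0].

Definition selectively_omega_bounded (X : topologicalType) : Prop :=
  forall U : nat -> set X,
    (forall n, open (U n)) -> (forall n, U n !=set0) ->
  exists2 x : nat -> X, forall n, U n (x n) &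
    exists2 k : nat -> nat, increasing_seq k &
      compact (closure (range (x \o k))).

(* Main.v *)
Require Import Defs.
From mathcomp Require Import all_boot all_order.
From mathcomp Require Import all_classical all_reals all_analysis.

Local Open Scope classical_set_scope.

(** In a Hausdorff space, selective omega-boundedness amounts to this: for every
    sequence [U] of nonempty open sets some compact [K] meets infinitely many
    [U n].  Given such a [K], choose the selected points in [K] whenever that is
    possible, and enumerate the set [hit U K] of the indices [n] such that [U n]
    meets [K] ([infinite_hit_selection]); conversely, the compact closure of a
    selected subsequence is such a [K].

    The class of Frolik asks for the same property of disjoint families, which
    gives one direction at once.  The content of the other one is the reduction
    of an arbitrary sequence [U] to a disjoint one.  If some point lies in
    infinitely many [U n], that point alone is the required compact set.
    Otherwise [U] is point-finite, and then infinitely many of the [U n] can be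
    shrunk to pairwise disjoint nonempty open sets ([disjoint_shrinking]).  The shrinking is a
    recursion that keeps an open set [G] met by infinitely many [U n], cuts a
    nonempty open [V] out of some [G `&` U n], and continues in an open subset of
    [G] that is disjoint from [V] and still met by infinitely many [U n]
    ([hit_split]). *)

Definition hit {T : Type} (U : nat -> set T) (A : set T) : set nat :=
  [set n | U n `&` A !=set0].

Lemma infinite_ltn (A : set nat) (N : nat) :
  infinite_set A -> exists2 n, A n & N < n.
Proof.
move=> Aoo; have [n [An nN]] := infinite_setN0 (infinite_setD Aoo (finite_II N.+1)).
by exists n => //; rewrite ltnNge; apply/negP => nleN; apply: nN.
Qed.

Lemma infinite_range_inj (T : Type) (f : nat -> T) :
  injective f -> infinite_set (range f).
Proof.
move=> finj /(finite_preimage (in2W finj)).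
by rewrite preimage_range; exact: infinite_nat.
Qed.

Lemma trivIset_nonempty_inj (I T : Type) (W : I -> set T) :
  (forall i, W i !=set0) -> trivIset setT W -> injective W.
Proof.
move=> W0 tW i j Wij; apply: (tW i j Logic.I Logic.I).
by rewrite Wij setIid; exact: W0.
Qed.

Lemma infinite_set_inj (T : pointedType) (A : set T) :
  infinite_set A -> exists2 f : nat -> T, injective f & forall n, A (f n).
Proof.
move=> /infiniteP/pcard_leP[f]; exists f; last by move=> n; exact: funS.
by move=> m n; apply: (@inj _ _ _ f); rewrite inE.
Qed.

Lemma infinite_hit_selection (X : topologicalType) (U : nat -> set X)
    (K : set X) :
  hausdorff_space X -> (forall n, U n !=set0) -> compact K ->
  infinite_set (hit U K) ->
  exists2 x : nat -> X, forall n, U n (x n) &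
    exists2 k : nat -> nat, increasing_seq k &
      compact (closure (range (x \o k))).
Proof.
move=> hX U0 cK Koo.
have /choice[x xP] n : exists y, U n y /\ (hit U K n -> K y).
  have [[y [Uy Ky]]|nK] := pselect (hit U K n); first by exists y.
  by have [y Uy] := U0 n; exists y.
exists x; first by move=> n; have [] := xP n.
have [|k [kincr _ kK]] := @infinite_increasing_seq_wf _ nat _ _ Koo 0.
  by move=> n; apply: sub_finite_set (finite_II n.+1) => m.
exists k => //; apply: (subclosed_compact _ cK); first exact: closed_closure.
rewrite ((closure_id K).1 (compact_closed hX cK)).
by apply: closureS => _ [n _ <-]; have [_] := xP (k n); apply; exact: kK.
Qed.

(** Point-finiteness gives [p] in some [U n `&` G] and [q] in some [U m `&` G]
    with [p] outside [U m], hence distinct from [q].  Separate [p] from [q] by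
    disjoint open sets [P] and [Q].  If infinitely many [U j] meet [P `&` G], keep
    that set and cut out the part of [U m `&` G] in [Q].  Otherwise cut out the
    part [V] of [U n `&` G] in [P]: a [U j] that meets [G] but not [P `&` G] is
    such that [U j `&` G] is open and disjoint from [V], so it still meets [G]
    outside [closure V]. *)
Lemma hit_split (X : topologicalType) (U : nat -> set X) (G : set X) (N : nat) :
  hausdorff_space X -> (forall n, open (U n)) ->
  (forall p, finite_set [set n | U n p]) ->
  open G -> infinite_set (hit U G) ->
  exists n V G',
    [/\ N < n, open V, V !=set0 & V `<=` U n `&` G] /\
    [/\ open G', G' `<=` G, V `&` G' = set0 & infinite_set (hit U G')].
Proof.
move=> hX oU Ufin oG Goo.
have [n [p [Unp Gp]] Nn] := infinite_ltn _ N Goo.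
have [m [[q [Umq Gq]] Ump] Nm] := infinite_ltn _ N (infinite_setD Goo (Ufin p)).
have pq : p != q by apply/eqP => pq; apply: Ump; rewrite /= pq.
move: hX; rewrite open_hausdorff => /(_ p q pq)[[P Q] /=].
rewrite !inE => -[Pp Qq] [oP oQ PQ].
have [Pfin|Poo] := pselect (finite_set (hit U (P `&` G))); last first.
  exists m, (U m `&` (Q `&` G)), (P `&` G); split; split => //.
  - by apply: openI => //; exact: openI.
  - by exists q.
  - by move=> z [? []].
  - exact: openI.
  - rewrite -subset0 => z [[_ [Qz _]] [Pz _]].
    by have : (P `&` Q) z by []; rewrite PQ.
pose V := U n `&` (P `&` G).
have oV : open V by apply: openI => //; exact: openI.
exists n, V, (G `&` ~` closure V); split; split => //.
- by exists p.
- by move=> z [? []].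
- by apply: openI => //; apply: closed_openC; exact: closed_closure.
- by apply/seteqP; split => // z [Vz [_]]; apply; exact: subset_closure.
apply: sub_infinite_set (infinite_setD Goo Pfin) => j [[z [Ujz Gz]] jP].
exists z; split=> //; split=> // /(_ (U j `&` G)) [].
  by apply: open_nbhs_nbhs; split => //; exact: openI.
by move=> w [[_ [Pw Gw]] [Ujw _]]; apply: jP; exists w.
Qed.

(** Iterating [hit_split] from the whole space, each time with the last index
    used as the lower bound [N], makes the indices strictly increase.  The pieces
    are disjoint because each lies in every earlier room, and a room is disjoint
    from the piece cut out when it was formed. *)
Lemma disjoint_shrinking (X : topologicalType) (U : nat -> set X) :
  hausdorff_space X -> (forall n, open (U n)) -> (forall n, U n !=set0) ->
  (forall p, finite_set [set n | U n p]) ->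
  exists (k : nat -> nat) (W : nat -> set X),
    [/\ increasing_seq k, forall i, open (W i), forall i, W i !=set0,
        forall i, W i `<=` U (k i) & trivIset setT W].
Proof.
move=> hX oU U0 Ufin.
pose good (s : set X * (nat * set X)) := open s.1 /\ infinite_set (hit U s.1).
(* A state (G, (n, V)) holds the remaining room G and the last piece V, cut out
   of U n; the initial n and V are placeholders, whence the shift by S below. *)
pose R (s t : {s | good s}) :=
  let: (G, (n, _)) := sval s in let: (G', (n', V')) := sval t in
  [/\ n < n', open V', V' !=set0 & V' `<=` U n' `&` G] /\
  (G' `<=` G /\ V' `&` G' = set0).
have good0 : good (setT, (0, set0)).
  split; first exact: openT.
  by rewrite (_ : hit _ _ = setT) ?setTT//; [exact: infinite_nat|];
    apply/seteqP; split => // n _ /=; rewrite /hit /= setIT; exact: U0.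
have [|f [_ fR]] := @dependent_choice _ R _ (exist _ _ good0).
  move=> [[G [N V0]] [/= oG Goo]]; apply: cid.
  have [n [V [G' [nV [oG' G'G VG' G'oo]]]]] :=
    hit_split _ _ _ N hX oU Ufin oG Goo.
  by exists (exist _ (G', (n, V)) (conj oG' G'oo)).
pose G i := (sval (f i)).1; pose k i := (sval (f i)).2.1.
pose W i := (sval (f i)).2.2.
have step i : [/\ k i < k i.+1, open (W i.+1), W i.+1 !=set0 &
     W i.+1 `<=` U (k i.+1) `&` G i] /\
   (G i.+1 `<=` G i /\ W i.+1 `&` G i.+1 = set0).
  move: (fR i); rewrite /R /k /W /G.
  by case: (sval (f i)) => ? [? ?]; case: (sval (f i.+1)) => ? [? ?].
have Ganti i j : i <= j -> G j `<=` G i.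
  move=> /subnK <-; elim: (j - i) => // d IH.
  by apply: subset_trans IH; rewrite addSn; have [_ []] := step (d + i).
exists (k \o S), (W \o S); split => /=.
- by apply/increasing_seqP => i; have [[]] := step i.+1.
- by move=> i; have [[]] := step i.
- by move=> i; have [[]] := step i.
- by move=> i x Wx; have [[_ _ _ /(_ x Wx)[]]] := step i.
- apply: ltn_trivIset => j i ij; apply/seteqP; split => // x [Wix Wjx].
  have [_ [_ <-]] := step i; split => //.
  have [[_ _ _ /(_ x Wjx)[_ Gjx]] _] := step j.
  exact: Ganti Gjx.
Qed.

Lemma frolik_Pstar_compact_hit (X : topologicalType) (U : nat -> set X) :
  hausdorff_space X -> frolik_Pstar X ->
  (forall n, open (U n)) -> (forall n, U n !=set0) ->
  exists2 K, compact K & infinite_set (hit U K).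
Proof.
move=> hX PX oU U0.
have [Ufin|/existsNP[p poo]] := pselect (forall p, finite_set [set n | U n p]);
  last first.
  exists [set p]; first exact: compact_set1.
  by apply: sub_infinite_set poo => n Unp; exists p.
have [k [W [kincr oW W0 WU tW]]] := disjoint_shrinking _ _ hX oU U0 Ufin.
have Winj := trivIset_nonempty_inj _ _ _ W0 tW.
have [|_ [n _ <-]||C' [C'W C'oo [K cK C'K]]] := PX (range W).
- exact: infinite_range_inj.
- exact: oW.
- by move=> _ _ [m _ <-] [n _ <-] /tW ->.
exists K => // Kfin; apply: C'oo.
have Ifin := finite_preimage (in2W (incn_inj kincr)) Kfin.
apply: sub_finite_set (finite_image W Ifin) => A C'A.
have [i _ WA] := C'W _ C'A; exists i => //.
have [x [Ax Kx]] := C'K _ C'A; exists x; split => //.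
by apply: WU; rewrite WA.
Qed.

Lemma frolik_Pstar_of_selectively_omega_bounded (X : topologicalType) :
  selectively_omega_bounded X -> frolik_Pstar X.
Proof.
move=> sX C Coo oC tC.
(* The empty set may belong to C, but no selection is possible from it. *)
have [U Uinj UC] := infinite_set_inj _ _ (infinite_setD Coo (finite_set1 set0)).
have [n|n|x xU [k kincr cK]] := sX U.
- by apply: oC; have [] := UC n.
- by have [_ /eqP/set0P] := UC n.
exists (range (U \o k)); split; last first.
- exists (closure (range (x \o k))) => // _ [n _ <-].
  by exists (x (k n)); split => //; apply: subset_closure; exists n.
- by apply: infinite_range_inj; apply: inj_comp Uinj (incn_inj kincr).
- by move=> _ [n _ <-]; have [] := UC (k n).
Qed.

Theorem lemma2p1 (X : topologicalType) (tychonoffX : tychonoff_space X) :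
  frolik_Pstar X <-> selectively_omega_bounded X.
Proof.
have [_ hX] := tychonoffX.
split; last exact: frolik_Pstar_of_selectively_omega_bounded.
move=> PX U oU U0.
have [K cK Koo] := frolik_Pstar_compact_hit _ _ hX PX oU U0.
exact: infinite_hit_selection Koo.
Qed.
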